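(* Let $H$ be a complex Hilbert space and let $T\in B(H)$ be a non-normal rank one operator with $\operatorname{tr}T\neq 0$. The following are equivalent: (i) $\mathcal S(T,T^* )$ is an SI semigroup. (ii) Either (but not both) of the following holds: the trace-norm condition $$(\operatorname{tr}T)^m\,(\overline{\operatorname{tr}T})^n\,\|T\|^{2l}=1\quad\text{for some integers } m,n\ge 0 \text{ with } m\ge 1 \text{ or } n\ge 1,\ \text{and } l\ge 1;$$ or $$\operatorname{tr}T\in\mathbb R\ \text{ and }\ \|T\|=1.$$ (An equivalent form of the trace-norm condition for given integers $m,n\ge0$ with $m$ or $n\ge1$ and $l\ge1$ is: if $m\neq n$, then $\arg(\operatorname{tr}T)=\frac{2\pi k}{m-n}$ (modulo $2\pi$) for some integer $0\le k<|m-n|$ and $|\operatorname{tr}T|=\|T\|^{-2l/(m+n)}$; if $m=n$, then $|\operatorname{tr}T|=\|T\|^{-l/m}$.)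
   Context: $H$ may be finite or infinite dimensional; $B(H)$ is the set of bounded linear operators on $H$. A semigroup $\mathcal S\subset B(H)$ is a subset closed under multiplication. $\mathcal S(T,T^* )$ is the semigroup generated by $\{T,T^*\}$, i.e. the set of all finite nonempty words in $T$ and $T^*$. An ideal $J$ of a semigroup $\mathcal S$ is a (two-sided) multiplicative ideal: a subset $J\subset\mathcal S$ with $XA, AX\in J$ for all $A\in J$, $X\in\mathcal S$ (no closure under sums or scalars is required). $\mathcal S$ is a selfadjoint-ideal (SI) semigroup if every ideal $J$ of $\mathcal S$ satisfies $\{A^*: A\in J\}\subset J$. $\operatorname{tr}$ denotes the trace and $\|\cdot\|$ the operator norm. *)

(* Defs.v *)
From HB Require Import structures.
From mathcomp Require Import all_boot all_order all_algebra finmap sesquilinear.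
From mathcomp Require Import all_classical all_reals all_analysis.
From mathcomp Require Import complex summability.

Set Implicit Arguments.
Unset Strict Implicit.
Unset Printing Implicit Defensive.

Import Order.TTheory GRing.Theory Num.Theory.
Import numFieldNormedType.Exports.

Local Open Scope classical_set_scope.
Local Open Scope ring_scope.

Section Hilbert.
Context {R : realType} {H : completeNormedModType R[i]}.

(* A Hilbert space is a complete normed space over R[i] together with an inner
   product (linear in the first argument) inducing its norm. *)
Definition hilbert_inner (ip : {dot H for Num.conj}) :=
  forall x : H, `|x| ^+ 2 = ip x x.

Definition bounded_operator (T : H -> H) :=
  linear T /\ exists M : R, forall x, `|T x| <= M%:C%C * `|x|.

(* Norms in H are R[i]-valued (with zero imaginary part), hence the use of Re. *)
Definition opnorm (T : H -> H) : R :=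
  sup [set complex.Re `|T x| | x in [set x : H | `|x| <= 1]].

Definition rank_one (T : H -> H) :=
  exists2 u : H, u != 0 & range T = [set a *: u | a in [set: R[i]]].

Section Operators.
Variable ip : {dot H for Num.conj}.

(* The default value T is irrelevant: by the Riesz representation theorem, a
   bounded operator has exactly one adjoint. *)
Definition adjoint (T : H -> H) : H -> H :=
  xget T [set S | bounded_operator S /\ forall x y, ip (T x) y = ip x (S y)].

Definition normal_operator (T : H -> H) := T \o adjoint T = adjoint T \o T.

Definition orthonormal_basis (E : set H) :=
  [/\ forall e, E e -> ip e e = 1,
      forall e f, E e -> E f -> e != f -> ip e f = 0 &
      forall x, (forall e, E e -> ip x e = 0) -> x = 0].

(* The sum over the (possibly uncountable) basis is unconditional, i.e. the limit
   of the finite partial sums along the filter of finite subsets of E. *)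
Definition is_trace (T : H -> H) (t : R[i]) :=
  forall E : set H, orthonormal_basis E ->
    partial_sum (fun e : E => ip (T (val e)) (val e) : R[i]^o) @ totally
      --> (t : R[i]^o).

Definition trace (T : H -> H) : R[i] := xget 0 [set t | is_trace T t].

Definition semigroup (S : set (H -> H)) :=
  S `<=` bounded_operator /\ forall A B, S A -> S B -> S (A \o B).

Inductive gen_semigroup (G : set (H -> H)) : set (H -> H) :=
| gen_semigroup_sub A of G A : gen_semigroup G A
| gen_semigroup_mul A B of gen_semigroup G A & gen_semigroup G B :
    gen_semigroup G (A \o B).

Definition semigroup_ideal (S J : set (H -> H)) :=
  J `<=` S /\ forall A X, J A -> S X -> J (X \o A) /\ J (A \o X).

Definition SI_semigroup (S : set (H -> H)) :=
  semigroup S /\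
  forall J, semigroup_ideal S J -> [set adjoint A | A in J] `<=` J.

Definition trace_norm_condition (T : H -> H) (m n l : nat) :=
  trace T ^+ m * (trace T)^* ^+ n * (opnorm T)%:C%C ^+ (2 * l) = 1.

End Operators.
End Hilbert.

Section Argument.
Context {R : realType}.

(* Principal argument, in ]-pi, pi]; meaningful for z != 0. *)
Definition carg (z : R[i]) : R :=
  xget 0 [set t | - pi < t <= pi /\ z = `|z| * (cos t +i* sin t)%C].

Definition eq_mod_2pi (s t : R) := exists j : int, s = t + 2 * pi * j%:~R.

End Argument.

(* Main.v *)
Require Import Defs.
From HB Require Import structures.
From mathcomp Require Import all_boot all_order all_algebra finmap sesquilinear.
From mathcomp Require Import all_classical all_reals all_analysis.
From mathcomp Require Import complex summability.
From mathcomp Require Import zify ring.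

Set Implicit Arguments.
Unset Strict Implicit.
Unset Printing Implicit Defensive.

Import Order.TTheory GRing.Theory Num.Theory.
Import numFieldNormedType.Exports.

Local Open Scope classical_set_scope.
Local Open Scope ring_scope.

(** A rank one operator with an adjoint is [T = <., v> u], and after rescaling
    [<u, u> = <v, v> = N = ||T||], while [t = <u, v> = tr T]. A word in [T] and
    [T^*] with first letter [a] and last letter [b] is then the scalar
    [t^m (t^* )^n N^k] times the rank one operator built from the vectors of [a]
    and [b], where [k] counts the changes of letter, so that [k] is even exactly
    when [a = b]; conversely every such scalar with [k >= 1] occurs. Since [T] is
    not normal, [u] and [v] are independent and [|t| < N], so the scalar and the
    end letters of a word are determined by the operator.

    If the semigroup is SI, then [s^* T^*] lies in the ideal generated by [s T],
    which forces [s^* = s t^m (t^* )^n N^(2 l)] with [l >= 1]. Taking [s = 1]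
    gives the trace-norm condition or [N = 1]; in the latter case [s = t] gives
    [t] real because [|t| < 1]. Conversely, a relation
    [t^m (t^* )^n N^(2 l) = 1] allows one to write the adjoint of any word [A] as
    [X A Y] with words [X] and [Y]. *)

(** * Inner products, orthonormal bases, and the trace of a rank one operator *)

Section InnerProduct.
Context {R : realType} {H : completeNormedModType R[i]}.
Variable ip : {dot H for Num.conj}.

Lemma ipZl c x y : ip (c *: x) y = c * ip x y.
Proof. by rewrite linearZl_LR. Qed.

Lemma ipZr c x y : ip x (c *: y) = c^* * ip x y.
Proof. by rewrite linearZr_LR. Qed.

Lemma ipC x y : ip y x = (ip x y)^*.
Proof. by rewrite (hermC ip y x) /= expr0 mul1r. Qed.

Lemma ip_eq0_sym x y : ip x y = 0 -> ip y x = 0.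
Proof. by move=> xy0; rewrite ipC xy0 conjC0. Qed.

Lemma ip_inj a b : (forall x, ip x a = ip x b) -> a = b.
Proof.
move=> ab; apply/eqP; rewrite -subr_eq0 -(dnorm_eq0 ip).
by rewrite raddfB /= ab subrr.
Qed.

(** [z] is [ip y y] times the component of [x] orthogonal to [y]; its square norm yields both
    Cauchy-Schwarz and the equality case. *)
Lemma dnorm_orthogonalization x y : let z := ip y y *: x - ip x y *: y in
  ip z z = ip y y * (ip x x * ip y y - `|ip x y| ^+ 2).
Proof.
move=> z; have zy : ip z y = 0.
  by rewrite /z linearBl /= !ipZl mulrC subrr.
rewrite {2}/z raddfB /= !ipZr zy mulr0 subr0 {1}/z linearBl /= !ipZl.
by rewrite (ipC x y) normCK -(ipC y y) (mulrC (ip y y) (ip x x)).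
Qed.

Lemma ip_CauchySchwarz x y : `|ip x y| ^+ 2 <= ip x x * ip y y.
Proof.
have [->|y0] := eqVneq y 0; first by rewrite !raddf0 normr0 expr0n mulr0.
have := dnorm_ge0 ip (ip y y *: x - ip x y *: y).
by rewrite dnorm_orthogonalization pmulr_rge0 ?dnorm_gt0// subr_ge0.
Qed.

Lemma ip_CauchySchwarz_eq x y : y != 0 -> `|ip x y| ^+ 2 = ip x x * ip y y ->
  x = (ip x y / ip y y) *: y.
Proof.
move=> y0 xy; have yy0 : ip y y != 0 by rewrite dnorm_eq0.
have := dnorm_orthogonalization x y; rewrite xy subrr mulr0 /= => /eqP.
rewrite dnorm_eq0 subr_eq0 => /eqP yxE.
by rewrite mulrC -scalerA -yxE scalerA mulVf// scale1r.
Qed.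

Definition orthonormal_set (E : set H) :=
  (forall e, E e -> ip e e = 1) /\
  (forall e f, E e -> E f -> e != f -> ip e f = 0).

(** Zorn's lemma is applied to the sets that stay orthonormal after adjoining [e0], so the empty
    chain causes no trouble. A nonzero vector orthogonal to a maximal one would, once normalised,
    enlarge it. *)
Lemma orthonormal_set_extends e0 : ip e0 e0 = 1 ->
  exists2 E, E e0 & orthonormal_basis ip E.
Proof.
move=> e01; pose P := [set E | orthonormal_set (e0 |` E)].
have [F FP Ftot|M [[M1 M0] Mmax]] := @Zorn_bigcup H P.
  split=> [e [->//|[X FX Xe]]|e f].
    by have [+ _] := FP _ FX; apply; right.
  have pair X a b : F X -> (e0 |` X) a -> (e0 |` X) b -> a != b -> ip a b = 0.
    by move=> /FP[_]; apply.
  move=> [->|[X FX Xe]] [->|[Y FY Yf]]; first by rewrite eqxx.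
  - by apply: (pair Y) => //; [left|right].
  - by apply: (pair X) => //; [right|left].
  - have [XY|YX] := Ftot _ _ FX FY.
      by apply: (pair Y) => //; right => //; exact: XY.
    by apply: (pair X) => //; right => //; exact: YX.
exists (e0 |` M); first by left.
split=> // x xM; apply/eqP; apply: contraT => x0.
have xx0 : 0 < ip x x by rewrite dnorm_gt0.
pose c := (sqrtC (ip x x))^-1; pose f := c *: x.
have ff : ip f f = 1.
  rewrite ipZl ipZr mulrA (CrealP _) ?ger0_real ?invr_ge0 ?sqrtC_ge0 ?ltW//.
  by rewrite -expr2 exprVn sqrtCK mulVf// gt_eqF.
have fM e : (e0 |` M) e -> ip f e = 0 by move=> /xM xe; rewrite ipZl xe mulr0.
have Mf : ~ M f.
  by move=> Mf; have := fM f (or_intror Mf); rewrite ff => /eqP; rewrite oner_eq0.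
exfalso; apply: (Mmax (f |` M)).
  by split=> [y My|/(_ f)]; [right|move=> /(_ (or_introl erefl))].
have sw y : (e0 |` (f |` M)) y -> y = f \/ (e0 |` M) y.
  by move=> [->|[->|My]]; [right; left|left|right; right].
split=> [e /sw[->|/M1]//|e g /sw[->|Me] /sw[->|Mg]].
- by rewrite eqxx.
- by move=> _; exact: fM.
- by move=> _; exact/ip_eq0_sym/fM.
- exact: M0.
Qed.

(** As [is_trace] speaks of every basis, it may be tested on one containing the normalised [u]: a
    single diagonal term survives, and the partial sums are eventually constant. *)
Lemma is_trace_rank_one (T : H -> H) (u v : H) (t : R[i]) :
  u != 0 -> (forall x, T x = ip x v *: u) -> is_trace ip T t -> t = ip u v.
Proof.
move=> u0 TE tr; have uu0 : 0 < ip u u by rewrite dnorm_gt0.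
pose c := sqrtC (ip u u); pose e0 := c^-1 *: u.
have c0 : c != 0 by rewrite sqrtC_eq0 gt_eqF.
have cc : c^-1^* = c^-1.
  by apply: CrealP; rewrite ger0_real ?invr_ge0 ?sqrtC_ge0 ?ltW.
have uE : u = c *: e0 by rewrite scalerA mulfV// scale1r.
have e01 : ip e0 e0 = 1.
  by rewrite ipZl ipZr cc mulrA -expr2 exprVn sqrtCK mulVf// gt_eqF.
clearbody e0; have [E Ee0 Eb] := orthonormal_set_extends e01.
have E0 := mem_set Ee0.
have [_ Eorth _] := Eb.
have termE (e : set_type E) : ip (T (val e)) (val e) =
    if e == SigSub E0 then ip u v else 0.
  rewrite TE; case: eqP => [->|/eqP ne] /=.
    by rewrite ipZl mulrC -/e0 uE !ipZl e01 mulr1.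
  rewrite ipZl uE ipZl (Eorth e0 (val e)) ?mulr0//.
  - exact: set_mem (valP e).
  - by apply: contra ne => /eqP h; apply/eqP/val_inj.
have cv := tr E Eb.
have totF := @totally_filter (set_type E).
apply: (@norm_cvg_unique _ (R[i]^o) _ (fmap_proper_filter _ totF) _ _ cv).
apply: cvg_near_cst; exists [fset SigSub E0]%fset => // A /=.
rewrite fsub1set => EA; rewrite /partial_sum.
under eq_bigr do rewrite termE.
rewrite -big_mkcond /= (big_pred1 [` EA]%fset)// => i /=.
Qed.

End InnerProduct.

(** * Rank one operators: adjoint, norm, trace and normal form *)

Section RankOne.
Context {R : realType} {H : completeNormedModType R[i]}.
Variable ip : {dot H for Num.conj}.
Hypothesis ipH : hilbert_inner ip.

Definition rank1 (a b : H) : H -> H := fun x => ip x b *: a.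

Lemma rank1Z c a b : rank1 (c *: a) b = rank1 a (c^* *: b).
Proof. by apply/funext => x; rewrite /rank1 ipZr conjCK scalerA mulrC. Qed.

Lemma rank1_left_line a b a' b' : b != 0 -> rank1 a b = rank1 a' b' ->
  exists c, a = c *: a'.
Proof.
move=> b0 /(congr1 (fun f => f b)); rewrite /rank1 => E.
exists ((ip b b)^-1 * ip b b').
by rewrite -scalerA -E scalerA mulVf ?scale1r// dnorm_eq0.
Qed.

Lemma rank1_comp a b a' b' : rank1 a b \o rank1 a' b' = rank1 (ip a' b *: a) b'.
Proof. by apply/funext => x /=; rewrite /rank1 ipZl scalerA. Qed.

Lemma ip_le_norm x y : `|ip x y| <= `|x| * `|y|.
Proof.
rewrite -(ler_pXn2r (n := 2)) ?nnegrE ?mulr_ge0//.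
by rewrite exprMn !ipH ip_CauchySchwarz.
Qed.

Lemma norm_ReK (x : H) : (complex.Re `|x|)%:C%C = `|x|.
Proof. by rewrite RRe_real// ger0_real. Qed.

Lemma rank1_norm_le a b x : `|rank1 a b x| <= `|a| * `|b| * `|x|.
Proof.
rewrite normrZ mulrC -mulrA ler_wpM2l// mulrC; exact: ip_le_norm.
Qed.

Lemma bounded_rank1 a b : bounded_operator (rank1 a b).
Proof.
split=> [c x y|]; first by rewrite /rank1 linearDl /= ipZl scalerDl scalerA.
exists (complex.Re `|a| * complex.Re `|b|) => x.
by rewrite rmorphM /= !norm_ReK rank1_norm_le.
Qed.

Lemma adjoint_rank1 a b : adjoint ip (rank1 a b) = rank1 b a.
Proof.
apply: xget_unique => [|S [_ adjS]].
  split=> [|x y]; first exact: bounded_rank1.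
  by rewrite /rank1 ipZl ipZr -ipC mulrC.
apply/funext => y; apply: (@ip_inj _ _ ip) => x.
by rewrite -adjS /rank1 ipZl ipZr -ipC mulrC.
Qed.

(** The supremum is attained at the normalised [b]; Cauchy-Schwarz gives the upper bound. *)
Lemma opnorm_rank1 a b : b != 0 -> (opnorm (rank1 a b))%:C%C = `|a| * `|b|.
Proof.
move=> b0; have nb0 : `|b| != 0 by rewrite normr_eq0.
rewrite -(norm_ReK a) -(norm_ReK b) -rmorphM /=; congr (_%:C)%C.
set r := _ * _.
pose A := [set complex.Re `|rank1 a b x| | x in [set x : H | `|x| <= 1]].
have Ar : A r.
  exists (`|b|^-1 *: b) => /=; first by rewrite normrZ normfV normr_id mulVf.
  rewrite /rank1 ipZl -ipH expr2 mulrA mulVf// mul1r normrZ normr_id mulrC.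
  by rewrite -(norm_ReK a) -(norm_ReK b) -rmorphM.
have ubr : ubound A r.
  move=> _ [x /= x1 <-]; rewrite -lecR norm_ReK rmorphM /= !norm_ReK.
  by rewrite (le_trans (rank1_norm_le a b x))// ler_piMr// mulr_ge0.
apply/eqP; rewrite eq_le ge_sup//=; last by exists r.
by apply: ub_le_sup => //; exists r.
Qed.

(** A nonzero trace is not the default value 0, so some [t] satisfies [is_trace], and its value is
    forced. *)
Lemma trace_rank1 a b : a != 0 -> trace ip (rank1 a b) != 0 ->
  trace ip (rank1 a b) = ip a b.
Proof.
move=> a0; rewrite /trace; case: xgetP => [t -> trt _|]; last by rewrite eqxx.
exact: is_trace_rank_one a0 _ trt.
Qed.

(* The junk value of [adjoint] makes an operator without an adjoint normal, so
   no Riesz representation theorem is needed. *)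
Lemma nonnormal_rank_oneP T : rank_one T -> ~ normal_operator ip T ->
  exists u v, [/\ T = rank1 u v, u != 0 & ip u u = ip v v].
Proof.
move=> [a a0 Ta] nT.
have [S _ adjS] : exists2 S, bounded_operator S &
    forall x y, ip (T x) y = ip x (S y).
  apply: contrapT => noadj; apply: nT; rewrite /normal_operator /adjoint.
  by rewrite xgetPN// => S [bS adjS]; apply: noadj; exists S.
have aa0 : 0 < ip a a by rewrite dnorm_gt0.
(* If [T x = c *: a], adjointness gives [c * ip a a = ip x (S a)], which dictates [b]. *)
pose b := (ip a a)^-1 *: S a.
have aaV : (ip a a)^-1^* = (ip a a)^-1 by apply/CrealP; rewrite ger0_real ?invr_ge0 ?ltW.
have Tab : T = rank1 a b.
  apply/funext => x; have [c _ cE] : [set c *: a | c in [set: R[i]]] (T x).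
    by rewrite -Ta; exists x.
  have := adjS x a; rewrite -cE ipZl => caa.
  by rewrite /rank1 /b ipZr aaV -caa mulrCA mulVf ?mulr1// gt_eqF.
clearbody b.
have b0 : b != 0.
  apply: contra_neq a0 => b0.
  have [x _] : range T a by rewrite Ta; exists 1 => //; rewrite scale1r.
  by rewrite Tab b0 /rank1 raddf0 scale0r.
have bb0 : 0 < ip b b by rewrite dnorm_gt0.
(* With this fourth root, [r *: a] and [r^-1 *: b] have the same norm. *)
pose r := sqrtC (sqrtC (ip b b / ip a a)).
have r0 : 0 < r by rewrite !sqrtC_gt0 divr_gt0.
have rr : r^* = r by apply/CrealP; rewrite ger0_real ?ltW.
have rrV : r^-1^* = r^-1 by apply/CrealP; rewrite ger0_real ?invr_ge0 ?ltW.
have r2 : r ^+ 2 = sqrtC (ip b b / ip a a) by rewrite sqrtCK.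
have r4 : r ^+ 4 = ip b b / ip a a by rewrite (exprM r 2 2) r2 sqrtCK.
clearbody r; exists (r *: a), (r^-1 *: b); split.
- by rewrite rank1Z rr scalerA mulfV ?scale1r ?gt_eqF.
- by rewrite scaler_eq0 negb_or a0 gt_eqF.
- rewrite !ipZl !ipZr rr rrV !mulrA -!expr2.
  apply: (@mulfI _ (r ^+ 2)); first by rewrite expf_neq0 ?gt_eqF.
  have rrV2 : r ^+ 2 / r / r = 1 by rewrite expr2 mulfK ?mulfV ?gt_eqF.
  by rewrite !mulrA -!exprSr r4 divfK ?gt_eqF// rrV2 mul1r.
Qed.

(** Equality in Cauchy-Schwarz would give [u = c *: v] with [c] of modulus 1, making the operator a
    scalar multiple of [rank1 v v], hence normal. *)
Lemma nonnormal_rank1_lt u v : u != 0 -> ip u u = ip v v ->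
  ~ normal_operator ip (rank1 u v) -> `|ip u v| < ip u u.
Proof.
move=> u0 uv nT; have uu0 : 0 < ip u u by rewrite dnorm_gt0.
rewrite lt_neqAle -(ler_pXn2r (n := 2)) ?nnegrE ?(ltW uu0)//.
rewrite [X in _ && (_ <= X)]expr2 [X in _ && (_ <= _ * X)]uv ip_CauchySchwarz andbT.
apply/eqP => eq1; apply: nT.
have v0 : v != 0 by rewrite -(dnorm_gt0 ip) -uv.
have /(ip_CauchySchwarz_eq v0) : `|ip u v| ^+ 2 = ip u u * ip v v.
  by rewrite eq1 expr2 -uv.
set c := _ / _ => uE.
have c1 : c * c^* = 1.
  have := uv; rewrite uE ipZl ipZr mulrA -[RHS]mul1r => /mulIf; apply.
  by rewrite -uv gt_eqF.
clearbody c; rewrite /normal_operator adjoint_rank1 !rank1_comp uv; clear -uE c1.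
rewrite uE; apply/funext => x; rewrite /rank1 ipZr !scalerA; congr (_ *: _).
rewrite -[RHS]mul1r -c1 -!mulrA [_ * c]mulrC !mulrA.
by rewrite [c^* * _ * _]mulrC !mulrA [c * _]mulrC.
Qed.

End RankOne.

(** * Words in [T] and its adjoint, and the ideals of their semigroup *)

Section WordSemigroup.
Context {R : realType} {H : completeNormedModType R[i]}.
Variable ip : {dot H for Num.conj}.
Hypothesis ipH : hilbert_inner ip.
Variables (u v : H) (t N : R[i]).
Hypotheses (uvE : ip u v = t) (uuE : ip u u = N) (vvE : ip v v = N).
Hypotheses (t0 : t != 0) (tN : `|t| < N).

(* Letters are booleans: [true] stands for T = rank1 u v and [false] for its
   adjoint rank1 v u; [wordop c a b] is the scalar c times a word whose first
   letter is a and whose last letter is b, with its inner factors removed. *)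
Definition letter_vec (a : bool) := if a then u else v.
Definition wordop c a b := rank1 ip (c *: letter_vec a) (letter_vec (~~ b)).

(** In a word, [m] counts the adjacent pairs of two [T], [n] the adjacent pairs of two adjoints, and
    [k] the changes of letter. *)
Definition weight m n k := t ^+ m * t^* ^+ n * N ^+ k.
Definition word_semigroup : set (H -> H) :=
  gen_semigroup [set wordop 1 true true; wordop 1 false false].
Local Notation S := word_semigroup.

Let N_gt0 : 0 < N. Proof. exact: le_lt_trans tN. Qed.
Let N_neq0 : N != 0. Proof. by rewrite gt_eqF. Qed.
Let NJ : N^* = N. Proof. by apply/CrealP; rewrite ger0_real// ltW. Qed.

Let weightJ m n k : (weight m n k)^* = weight n m k.
Proof. by rewrite /weight !rmorphM !rmorphXn /= conjCK NJ [X in X * _]mulrC. Qed.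

Let weightM m n k m' n' k' :
  weight m n k * weight m' n' k' = weight (m + m') (n + n') (k + k').
Proof. by rewrite /weight !exprD; ring. Qed.

(** This is the factor arising where a word ending in [b] is followed by one starting with [a]. *)
Lemma letter_ip a b : ip (letter_vec a) (letter_vec (~~ b)) =
  weight (a && b) (~~ a && ~~ b) (a (+) b).
Proof.
case: a b => -[]; rewrite /weight /letter_vec /= ?uvE ?uuE ?vvE.
- by rewrite expr0 expr1 !mulr1.
- by rewrite !expr0 expr1 !mul1r.
- by rewrite !expr0 expr1 !mul1r.
- by rewrite ipC uvE !expr0 expr1 mul1r mulr1.
Qed.

Lemma wordop_comp c a b c' a' b' : wordop c a b \o wordop c' a' b' =
  wordop (c * c' * weight (a' && b) (~~ a' && ~~ b) (a' (+) b)) a b'.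
Proof.
rewrite /wordop rank1_comp ipZl letter_ip scalerA; congr (rank1 _ (_ *: _) _).
by ring.
Qed.

Lemma adjoint_wordop c a b : adjoint ip (wordop c a b) = wordop c^* (~~ b) (~~ a).
Proof. by rewrite /wordop rank1Z adjoint_rank1// negbK. Qed.

Lemma letter_vec_neq0 a : letter_vec a != 0.
Proof. by rewrite -(dnorm_gt0 ip); case: a; rewrite /= ?uuE ?vvE. Qed.

(** Both vectors have square norm [N], so proportionality forces a factor of modulus 1; for distinct
    letters this gives [|t| = N]. *)
Lemma letter_vec_free c a b : letter_vec a = c *: letter_vec b -> a = b.
Proof.
have [//|ab aE] := eqVneq a b; exfalso.
have ipab : `|ip (letter_vec a) (letter_vec b)| = `|t|.
  move: ab; case: (a) (b) => -[]//= _; rewrite ?uvE//.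
  by rewrite ipC uvE norm_conjC.
have ipaa x : ip (letter_vec x) (letter_vec x) = N by case: x.
have := ipaa a; rewrite {1 2}aE ipZl ipZr ipaa mulrA -normCK => c1.
move: ipab; rewrite aE ipZl ipaa normrM (gtr0_norm N_gt0).
have -> : `|c| = 1.
  apply/eqP; rewrite -(@pexpr_eq1 _ _ 2)//; apply/eqP.
  by apply: (mulIf N_neq0); rewrite c1 mul1r.
by rewrite mul1r => NE; move: tN; rewrite NE ltxx.
Qed.

(** The range determines the first letter, the adjoint's range the last one, and evaluation at a
    single vector the scalar. *)
Lemma wordop_inj c a b c' a' b' : c != 0 -> wordop c a b = wordop c' a' b' ->
  [/\ a = a', b = b' & c = c'].
Proof.
move=> c0.
have first d d' x y x' y' : d != 0 -> wordop d x y = wordop d' x' y' -> x = x'.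
  move=> d0 /rank1_left_line[|s /(congr1 ( *:%R d^-1))].
    exact: letter_vec_neq0.
  by rewrite !scalerA mulVf// scale1r => /letter_vec_free.
move=> E; have aE := first _ _ _ _ _ _ c0 E.
have /(first _ _ _ _ _ _) : wordop c^* (~~ b) (~~ a) = wordop c'^* (~~ b') (~~ a').
  by rewrite -!adjoint_wordop E.
rewrite conjC_eq0 => /(_ c0)/negb_inj bE; split=> //.
move: E => /(congr1 (fun f => f (letter_vec (~~ b)))).
rewrite -aE -bE /wordop /rank1 => /eqP.
rewrite -subr_eq0 -scalerBr -scalerBl !scaler_eq0 dnorm_eq0.
by rewrite !(negbTE (letter_vec_neq0 _)) orbF subr_eq0 => /eqP.
Qed.

Lemma letter_in_semigroup a : S (wordop 1 a a).
Proof. by apply: gen_semigroup_sub; case: a; [left|right]. Qed.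

Lemma word_semigroup_bounded : S `<=` bounded_operator.
Proof.
have SE A : S A -> exists c a b, A = wordop c a b.
  elim=> {A} [A [] -> |_ _ _ [c [a [b ->]]] _ [c' [a' [b' ->]]]].
  - by exists 1, true, true.
  - by exists 1, false, false.
  - by rewrite wordop_comp; do 3 eexists.
by move=> A /SE[c [a [b ->]]]; exact: bounded_rank1.
Qed.

Lemma word_semigroup_weight A : S A -> exists m n k a b,
  A = wordop (weight m n k) a b /\ odd k = a (+) b.
Proof.
have w0 : weight 0 0 0 = 1 by rewrite /weight !expr0 !mulr1.
elim=> {A} [A [] -> |_ _ _ [m [n [k [a [b [-> kab]]]]]]
                      _ [m' [n' [k' [a' [b' [-> kab']]]]]]].
- by exists 0%N, 0%N, 0%N, true, true; rewrite w0.
- by exists 0%N, 0%N, 0%N, false, false; rewrite w0.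
- rewrite wordop_comp !weightM; do 5 eexists; split; first by [].
  by rewrite !oddD kab kab' oddb; case: (a) (b) (a') (b') => -[] [] [].
Qed.

(** The word is the letter [a] repeated [n + 1] times. *)
Lemma letterX_in_semigroup a n : S (wordop ((if a then t else t^* ) ^+ n) a a).
Proof.
elim: n => [|n IH]; first exact: letter_in_semigroup.
have := gen_semigroup_mul (letter_in_semigroup a) IH; rewrite wordop_comp.
congr (S (wordop _ _ _)); rewrite exprS mul1r mulrC; congr (_ * _).
by rewrite /weight; case: a {IH}; rewrite /= !(expr0, expr1, mulr1, mul1r).
Qed.

(** Powers [m + 1] of [T] and [n + 1] of its adjoint, side by side, realise one change of letter;
    each further change is one alternating letter put in front. *)
Lemma weight_in_semigroup m n k a b : odd k.+1 = a (+) b ->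
  S (wordop (weight m n k.+1) a b).
Proof.
elim: k a b => [|k IH] a b.
  move=> /esym; rewrite /weight.
  case: a b => -[]//= _.
    have := gen_semigroup_mul (letterX_in_semigroup true m)
      (letterX_in_semigroup false n).
    by rewrite wordop_comp /weight /= !(expr0, expr1, mulr1, mul1r).
  have := gen_semigroup_mul (letterX_in_semigroup false n)
    (letterX_in_semigroup true m).
  rewrite wordop_comp /weight /= !(expr0, expr1, mulr1, mul1r).
  by rewrite [_ ^+ n * _]mulrC.
move=> kab; have /IH : odd k.+1 = ~~ a (+) b by rewrite addNb -kab /= negbK.
move=> /(gen_semigroup_mul (letter_in_semigroup a)); rewrite wordop_comp.
congr (S (wordop _ _ _)); rewrite mul1r weightM.
by case: a {IH kab}; rewrite /= !addn0 addn1.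
Qed.

Lemma word_semigroup_semigroup : semigroup S.
Proof. by split; [exact: word_semigroup_bounded|exact: gen_semigroup_mul]. Qed.

(* Contains the ideal generated by s T: each end of a word that differs from the
   letter T costs at least one change of letter, hence one factor N. *)
Definition weighted_ideal (s : R[i]) : set (H -> H) :=
  [set A | S A /\ exists m n k a b,
    [/\ A = wordop (s * weight m n k) a b, odd k = a (+) b & (~~ a + ~~ b <= k)%N]].

Lemma weighted_ideal_ideal s : semigroup_ideal S (weighted_ideal s).
Proof.
have mulCs (x y z : R[i]) : x * (s * y) * z = s * (x * y * z) by ring.
have mulAs (x y z : R[i]) : s * x * y * z = s * (x * y * z) by ring.
split=> [A []//|A X [SA [m [n [k [a [b [AE kab kl]]]]]]] SX].
have [m' [n' [k' [a' [b' [XE kab']]]]]] := word_semigroup_weight SX.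
split; (split; first exact: gen_semigroup_mul).
- rewrite XE AE wordop_comp mulCs !weightM.
  do 5 eexists; split; first by [].
  + by rewrite !oddD kab kab' oddb; case: (a) (b) (a') (b') => -[] [] [].
  (* If the new end letter differs from the old one, parity forces a change of letter inside [X] or
     at the junction, which pays for the new end. *)
  + by move: kab kl kab'; case: (a) (b) (a') (b') => -[] [] [] /=; lia.
- rewrite XE AE wordop_comp mulAs !weightM.
  do 5 eexists; split; first by [].
  + by rewrite !oddD kab kab' oddb; case: (a) (b) (a') (b') => -[] [] [].
  + by move: kab kl kab'; case: (a) (b) (a') (b') => -[] [] [] /=; lia.
Qed.

(** Both ends of the adjoint of [s T] differ from the letter [T], so its exponent of [N] is at least
    2; it is even because the two ends agree. *)
Lemma SI_weight_conj (s : R[i]) : s != 0 -> S (wordop s true true) -> SI_semigroup ip S ->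
  exists m n l, (1 <= l)%N /\ s^* = s * weight m n (2 * l).
Proof.
move=> s0 Ss [_ SI].
have sJ : weighted_ideal s (wordop s true true).
  split=> //; exists 0%N, 0%N, 0%N, true, true; split=> //.
  by rewrite /weight !expr0 !mulr1.
have [_ [m [n [k [a [b [E kab kl]]]]]]] : weighted_ideal s (wordop s^* false false).
  rewrite -(adjoint_wordop s true true).
  by apply: (SI _ (weighted_ideal_ideal s)); exists (wordop s true true).
have sJ0 : s^* != 0 by rewrite conjC_eq0.
have [aE bE cE] := wordop_inj sJ0 E.
exists m, n, k./2; move: kab kl; rewrite -aE -bE /= => k0 k2.
by split; [lia|rewrite {}cE; congr (_ * weight _ _ _); lia].
Qed.

Lemma SI_conditions : SI_semigroup ip S ->
  (exists m n l, [/\ (1 <= m)%N \/ (1 <= n)%N, (1 <= l)%N &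
     weight m n (2 * l) = 1]) \/ (t \is Num.real /\ N = 1).
Proof.
move=> SI.
have [m [n [l [l1]]]] := SI_weight_conj (oner_neq0 _) (letter_in_semigroup true) SI.
rewrite conjC1 mul1r => /esym w1.
have [mn0|mn0] := posnP (m + n); last first.
  left; exists m, n, l; split=> //.
  by move: mn0; rewrite addn_gt0 => /orP.
right; move: w1; have [-> ->] : m = 0%N /\ n = 0%N by lia.
rewrite /weight !expr0 !mul1r => /eqP; rewrite pexpr_eq1 ?(ltW N_gt0)//; last by lia.
move=> /eqP N1; split=> //.
(* The word [T T] is [t T], so [s = t] is allowed. *)
have [m' [n' [l' [_]]]] := SI_weight_conj t0 (letterX_in_semigroup true 1) SI.
rewrite /weight N1 expr1n mulr1 => tE.
have [mn0'|mn0'] := posnP (m' + n').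
  move: tE; have [-> ->] : m' = 0%N /\ n' = 0%N by lia.
  by rewrite !expr0 !mulr1 => tE; apply/CrealP.
(* A positive exponent would give [|t| = 1 = N], against [|t| < N]. *)
exfalso; move/(congr1 Num.norm): tE.
rewrite !normrM !normrX norm_conjC -exprD -[LHS]mulr1.
move=> /(mulfI _)-/(_ _)/esym/eqP; rewrite normr_eq0 => /(_ t0).
rewrite pexpr_eq1// => /eqP t1.
by move: tN; rewrite N1 t1 ltxx.
Qed.

Lemma conditions_exclusive m n l : (1 <= m)%N \/ (1 <= n)%N -> N = 1 ->
  weight m n l <> 1.
Proof.
move=> mn N1; rewrite /weight N1 expr1n mulr1 => /(congr1 Num.norm)/eqP.
rewrite normrM !normrX norm_conjC -exprD normr1 pexpr_eq1//; last first.
  by rewrite addn_gt0; apply/orP.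
by move=> /eqP t1; move: tN; rewrite N1 t1 ltxx.
Qed.

Lemma SI_of_weight1 m n l : (1 <= m)%N \/ (1 <= n)%N -> (1 <= l)%N ->
  weight m n (2 * l) = 1 -> SI_semigroup ip S.
Proof.
move=> mn l1 w1; split; first exact: word_semigroup_semigroup.
pose K := (m + n)%N; pose L := (2 * l)%N.
(* The relation times its conjugate, raised to the power [j]: a way to write 1 with all three
   exponents as large as desired. *)
have wK j : weight (K * j) (K * j) (2 * L * j) = 1.
  have : weight m n (2 * l) * weight n m (2 * l) = 1.
    by rewrite -(weightJ m) w1 conjC1 mulr1.
  rewrite weightM => w2.
  rewrite /weight !(exprM _ K) (exprM _ (2 * L)) -!exprMn -[RHS](expr1n _ j).
  congr (_ ^+ j); rewrite -w2 /K /L.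
  rewrite exprMn -/(weight (m + n) (m + n) (2 * (2 * l))).
  by congr (weight _ _ _); lia.
move=> J [JS Jid] _ [A JA <-].
have [p [q [k [a [b [AE kab]]]]]] := word_semigroup_weight (JS _ JA).
(* [j] is large enough that no subtraction in [x] truncates; [k1] is the least positive number of
   changes with the parity required of [Y]. *)
pose j := (p + q).+4; pose k1 := (a == b).+1.
have pqK : (p + q + 4 <= K * j)%N by rewrite /j /K; nia.
have jL : (8 <= 2 * L * j)%N by rewrite /j /L; nia.
have k1ab : odd k1 = a (+) b by rewrite /k1; case: (a) (b) => -[].
have k12 : (k1 <= 2)%N by rewrite /k1; case: eqP.
(* These exponents are what remains of the adjoint's weight times [wK j] after removing those of
   [A], those of [Y], and the two changes of letter where [X], [A] and [Y] meet. *)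
pose x := weight (q + K * j - p) (p + K * j - q) (2 * L * j - 2 - k1).-1.+1.
pose X := wordop x (~~ b) (~~ a).
pose Y := wordop (weight 0 0 k1) (~~ b) (~~ a).
have SX : S X.
  by apply: weight_in_semigroup; rewrite addbC addNb addbN negbK -k1ab; lia.
have SY : S Y by apply: weight_in_semigroup; rewrite addbC addNb addbN negbK -k1ab.
suff -> : adjoint ip A = X \o (A \o Y) by apply (Jid _ X) => //; apply (Jid A Y).
rewrite AE adjoint_wordop weightJ -[weight q p k]mulr1 -(wK j).
rewrite !wordop_comp !weightM.
congr (wordop (weight _ _ _) _ _).
all: by case: (a) (b) k12 => -[] /=; lia.
Qed.

(** All scalars are real, so a word with distinct ends is selfadjoint. With equal ends, its adjoint
    is the word flanked by the opposite letter, the junctions costing only [N = 1]. *)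
Lemma SI_of_real_unit : t \is Num.real -> N = 1 -> SI_semigroup ip S.
Proof.
move=> /CrealP tJ N1; split; first exact: word_semigroup_semigroup.
move=> J [JS Jid] _ [A JA <-].
have [p [q [k [a [b [AE kab]]]]]] := word_semigroup_weight (JS _ JA).
have wJ : (weight p q k)^* = weight p q k.
  by rewrite weightJ /weight tJ [X in X * _]mulrC.
have [ab|ab] := eqVneq a b.
  suff -> : adjoint ip A = wordop 1 (~~ a) (~~ a) \o (A \o wordop 1 (~~ a) (~~ a)).
    apply (Jid _ (wordop 1 (~~ a) (~~ a))); last exact: letter_in_semigroup.
    by apply (Jid A (wordop 1 (~~ a) (~~ a))) => //; exact: letter_in_semigroup.
  rewrite AE adjoint_wordop wJ !wordop_comp -ab; congr (wordop _ _ _).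
  by rewrite /weight N1; case: (a); rewrite /= !(expr0, expr1, mulr1, mul1r).
suff -> : adjoint ip A = A by [].
by rewrite AE adjoint_wordop wJ; move: ab; case: (a) (b) => -[].
Qed.

End WordSemigroup.

(** * Polar form and the argument version of the trace-norm condition *)

Section Polar.
Context {R : realType}.
Implicit Types (x y : R) (z : R[i]).

Definition cis x : R[i] := (cos x +i* sin x)%C.

Lemma cisD x y : cis (x + y) = cis x * cis y.
Proof.
by rewrite /cis cosD sinD; apply/eqP; rewrite eq_complex /= eqxx/= addrC.
Qed.

Lemma cis0 : cis 0 = 1.
Proof. by rewrite /cis cos0 sin0. Qed.

Lemma norm_cis x : `|cis x| = 1.
Proof. by rewrite normc_def /= cos2Dsin2 sqrtr1. Qed.

Lemma conj_cis x : (cis x)^* = cis (- x).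
Proof. by rewrite /cis cosN sinN. Qed.

Lemma cisX x n : cis x ^+ n = cis (x *+ n).
Proof.
by elim: n => [|n IH]; rewrite ?mulr0n ?cis0 ?expr0// exprS IH mulrS cisD.
Qed.

Lemma cis_2pi_int (j : int) : cis (2 * pi * j%:~R) = 1.
Proof.
have cisn n : cis (2 * pi * n%:R) = 1.
  have c2 : cis (2 * pi) = 1 by rewrite mulr_natl /cis cos2pi sin2pi.
  by rewrite mulr_natr -cisX c2 expr1n.
case: j => n; first exact: cisn.
by rewrite NegzE mulrN -conj_cis cisn conjC1.
Qed.

Lemma cis_eq1 x : cis x = 1 -> exists j : int, x = 2 * pi * j%:~R.
Proof.
move=> cx; have pi0 := pi_gt0 R.
pose j := Num.floor (x / (2 * pi)); exists j.
have /andP[jl jr] := floor_itv (x / (2 * pi)).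
pose y := x - 2 * pi * j%:~R.
have cy : cis y = 1.
  by rewrite /y cisD cx mul1r -mulrN -mulrNz cis_2pi_int.
suff y0 : y = 0 by apply/eqP; rewrite -subr_eq0 -/y y0.
have yl : 0 <= y.
  by rewrite subr_ge0 mulrC -ler_pdivlMr// mulr_gt0.
have yr : y < 2 * pi.
  rewrite ltrBlDl -[X in _ + X]mulr1 -mulrDr mulrC -ltr_pdivrMr ?mulr_gt0//.
  by move: jr; rewrite -/j intrD.
move: cy => [cosy siny].
have [ypi|piy] := leP y pi.
  by apply: cos_inj; rewrite ?in_itv /= ?yl ?lexx ?(ltW pi0)// cosy cos0.
(* Beyond [pi], reflection brings the angle back to the interval where [cos] is injective. *)
have : 2 * pi - y = 0.
  apply: cos_inj; rewrite ?in_itv /= ?lexx ?(ltW pi0)//.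
    by rewrite subr_ge0 (ltW yr) lerBlDr mulr_natl mulr2n lerD2l (ltW piy).
  by rewrite cosB mulr_natl cos2pi sin2pi cosy cos0 mul0r addr0 mulr1.
by move=> /eqP; rewrite subr_eq0 => /eqP ye; move: yr; rewrite ye ltxx.
Qed.

(** [carg] is chosen by [xget], so an admissible angle must be exhibited: for [a + i b] of modulus 1
    it is [acos a] or its negative, by the sign of [b]. *)
Lemma polar_decomposition z : z != 0 -> z = `|z| * cis (carg z).
Proof.
move=> z0; rewrite /carg.
suff [x xP] : exists x, - pi < x <= pi /\ z = `|z| * (cos x +i* sin x)%C.
  by have [] := xgetI 0 (P := [set x | - pi < x <= pi /\ z = _]) xP.
have nz0 : `|z| != 0 by rewrite normr_eq0.
pose w := z / `|z|; have w1 : `|w| = 1 by rewrite normf_div normr_id divff.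
suff [x xr wE] : exists2 x, - pi < x <= pi & w = cis x.
  by exists x; split => //; rewrite -[X in _ * X]wE mulrC divfK.
move: w w1 => [a b] ab1; have pi0 := pi_gt0 R.
have ab : a ^+ 2 + b ^+ 2 = 1.
  by apply: complexI; rewrite (add_Re2_Im2 (a +i* b)%C) ab1 expr1n.
have a11 : -1 <= a <= 1.
  rewrite -ler_norml -(ler_pXn2r (n := 2)) ?nnegrE// expr1n.
  by rewrite real_normK ?num_real// -ab lerDl sqr_ge0.
have acK : cos (acos a) = a by apply: acosK; rewrite in_itv.
have sE : sin (acos a) = `|b|.
  by rewrite sin_acos// -ab addrAC subrr add0r sqrtr_sqr.
have [b0|b0] := leP 0 b.
  exists (acos a); last by rewrite /cis acK sE ger0_norm.
  by rewrite acos_lepi// andbT (lt_le_trans _ (acos_ge0 a11))// oppr_lt0.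
exists (- acos a); last by rewrite /cis cosN sinN acK sE ltr0_norm ?opprK.
(* The angle [- pi] is excluded: it would need [a = -1], hence [b = 0]. *)
rewrite ltrN2 acos_ltpi/=; last first.
  move/andP: a11 => [a1 ->]; rewrite andbT lt_neqAle a1 andbT.
  apply/eqP => am1; move: ab; rewrite -am1 sqrrN expr1n => /eqP.
  by rewrite -[X in _ == X]addr0 (inj_eq (addrI _)) sqrf_eq0 lt_eqF.
by rewrite lerNl (le_trans _ (acos_ge0 a11))// oppr_le0 ltW.
Qed.

Lemma conj_monomial_polar z (N : R) m n l : z != 0 ->
  z ^+ m * z^* ^+ n * N%:C%C ^+ l =
  `|z| ^+ (m + n) * N%:C%C ^+ l * cis (carg z * (m%:Z - n%:Z)%:~R).
Proof.
move=> z0; rewrite {1 2}(polar_decomposition z0) rmorphM /= conj_normC conj_cis.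
rewrite !exprMn !cisX intrD mulrDr cisD mulrNz mulrN.
rewrite -mulNr -!pmulrn !mulr_natr exprD.
by rewrite mulrACA -!mulrA; congr (_ * (_ * _)); rewrite mulrA mulrC.
Qed.

Lemma mul_phase_eq1 (r : R) x : 0 < r -> r%:C%C * cis x = 1 -> r = 1 /\ cis x = 1.
Proof.
move=> r0 rx; have r1 : r = 1.
  apply: complexI; move/(congr1 Num.norm): rx.
  by rewrite normrM norm_cis mulr1 normr1 ger0_norm// ler0c ltW.
by split=> //; move: rx; rewrite r1 mul1r.
Qed.

(** From [x * d = 2 pi j], division of [j] by [d] gives [k] as remainder, while the quotient counts
    full turns. *)
Lemma cis_int_multiple_eq1 x (d : int) : d != 0 ->
  cis (x * d%:~R) = 1 <->
  exists2 k : nat, (k < absz d)%N & eq_mod_2pi x (2 * pi * k%:R / d%:~R).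
Proof.
move=> d0; have dR0 : d%:~R != 0 :> R by rewrite intr_eq0.
split=> [/cis_eq1[j xdE]|[k _ [j ->]]].
  exists `|(j %% d)%Z|%N; first by rewrite -ltz_nat gez0_abs ?modz_ge0 ?ltz_mod.
  exists (j %/ d)%Z; have xE : x = 2 * pi * j%:~R / d%:~R by rewrite -xdE mulfK.
  rewrite xE {1}(divz_eq j d) (pmulrn 1 `|_|) gez0_abs ?modz_ge0// intrD intrM.
  by rewrite mulrDr mulrDl mulrA mulfK// addrC.
rewrite mulrDl divfK// -[_ * j%:~R * _]mulrA -intrM cisD cis_2pi_int mulr1.
exact: (cis_2pi_int k).
Qed.

Lemma pow_mul_pow_eq1 (r N : R) p q : 0 <= r -> 0 < N -> (0 < p)%N ->
  r ^+ p * N ^+ q = 1 <-> r = N `^ (- q%:R / p%:R).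
Proof.
move=> r0 N0 p0; have Nq0 : N ^+ q != 0 by rewrite expf_neq0 ?gt_eqF.
have pR0 : p%:R != 0 :> R by rewrite pnatr_eq0 -lt0n.
have NE : (N `^ (- q%:R / p%:R)) ^+ p * N ^+ q = 1.
  rewrite -powR_mulrn ?powR_ge0// -powRrM divfK// powRN.
  by rewrite powR_mulrn ?ltW// mulVf.
split=> [rN|-> //]; apply: (pexpIrn p0); rewrite ?nnegrE ?powR_ge0//.
by apply: (mulIf Nq0); rewrite rN NE.
Qed.

Lemma trace_norm_polar z (N : R) m n l : z != 0 -> 0 < N -> (0 < m + n)%N ->
  z ^+ m * z^* ^+ n * N%:C%C ^+ (2 * l) = 1 <->
  cis (carg z * (m%:Z - n%:Z)%:~R) = 1 /\
  `|z| = (N `^ (- (2 * l)%:R / (m + n)%:R))%:C%C.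
Proof.
move=> z0 N0 mn0; rewrite conj_monomial_polar//.
have [r r0 rE] : exists2 r : R, 0 < r & `|z| = r%:C%C.
  exists (complex.Re `|z|); last by rewrite RRe_real// ger0_real.
  by rewrite -ltcR RRe_real ?normr_gt0// ger0_real.
have rNE : `|z| ^+ (m + n) * N%:C%C ^+ (2 * l) = (r ^+ (m + n) * N ^+ (2 * l))%:C%C.
  by rewrite rE rmorphM !rmorphXn.
have rN0 : 0 < r ^+ (m + n) * N ^+ (2 * l) by rewrite mulr_gt0 ?exprn_gt0.
rewrite rNE rE; have rP := pow_mul_pow_eq1 (2 * l) (ltW r0) N0 mn0.
split=> [/(mul_phase_eq1 rN0)[/rP rE' ->]|[-> /complexI/rP ->]]; last first.
  by rewrite mulr1.
by split; rewrite ?rE'.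
Qed.

Lemma trace_norm_arg_form z (N : R) m n l : z != 0 -> 0 < N ->
  (1 <= m)%N \/ (1 <= n)%N ->
  (m <> n ->
     (z ^+ m * z^* ^+ n * N%:C%C ^+ (2 * l) = 1 <->
      (exists2 k : nat, (k < absz (m%:Z - n%:Z)%R)%N &
        eq_mod_2pi (carg z) (2 * pi * k%:R / (m%:Z - n%:Z)%:~R)) /\
      `|z| = (N `^ (- (2 * l)%:R / (m + n)%:R))%:C%C)) /\
  (m = n ->
     (z ^+ m * z^* ^+ n * N%:C%C ^+ (2 * l) = 1 <->
      `|z| = (N `^ (- l%:R / m%:R))%:C%C)).
Proof.
move=> z0 N0 mn; have mn0 : (0 < m + n)%N by rewrite addn_gt0; apply/orP.
have tP := trace_norm_polar l z0 N0 mn0; split=> [mnE|mnE].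
  have d0 : (m%:Z - n%:Z)%R != 0 :> int by rewrite subr_eq0; apply/eqP => -[].
  by have kP := cis_int_multiple_eq1 (carg z) d0; rewrite tP kP.
rewrite tP -mnE subrr mulr0 cis0.
have -> : - (2 * l)%:R / (m + m)%:R = - l%:R / m%:R :> R.
  by rewrite addnn -mul2n !natrM !mulNr invfM mulrACA divff ?mul1r// pnatr_eq0.
by split=> [[]|->].
Qed.

End Polar.

(** * Transfer from the normalised vectors [u], [v] back to [T] *)

Theorem theorem3p15 (R : realType) (H : completeNormedModType R[i])
    (ip : {dot H for Num.conj}) (ipH : hilbert_inner ip)
    (T : H -> H) (T_bounded : bounded_operator T) (T_rank1 : rank_one T)
    (T_nonnormal : ~ normal_operator ip T) (trT_neq0 : trace ip T != 0) :
  let trace_norm := exists m n l : nat,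
    [/\ (1 <= m)%N \/ (1 <= n)%N, (1 <= l)%N & trace_norm_condition ip T m n l] in
  let real_unit := trace ip T \is Num.real /\ opnorm T = 1 in
  (SI_semigroup ip (gen_semigroup [set T; adjoint ip T]) <->
     (trace_norm /\ ~ real_unit) \/ (~ trace_norm /\ real_unit))
  /\
  (forall m n l : nat, (1 <= m)%N \/ (1 <= n)%N -> (1 <= l)%N ->
     (m <> n ->
        (trace_norm_condition ip T m n l <->
         (exists2 k : nat, (k < absz (m%:Z - n%:Z)%R)%N &
            eq_mod_2pi (carg (trace ip T))
              (2 * pi * k%:R / (m%:Z - n%:Z)%:~R)) /\
         `|trace ip T| = (opnorm T `^ (- (2 * l)%:R / (m + n)%:R))%:C%C)) /\
     (m = n ->
        (trace_norm_condition ip T m n l <->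
         `|trace ip T| = (opnorm T `^ (- l%:R / m%:R))%:C%C))).
Proof.
move=> trace_norm real_unit.
have [u [v [TE u0 uv]]] := nonnormal_rank_oneP T_rank1 T_nonnormal.
rewrite {}TE in T_nonnormal trT_neq0 trace_norm real_unit *.
have tN := nonnormal_rank1_lt ipH u0 uv T_nonnormal.
have trE := trace_rank1 u0 trT_neq0.
have v0 : v != 0 by rewrite -(dnorm_gt0 ip) -uv dnorm_gt0.
(* Equal norms of [u] and [v] identify [N] with the operator norm. *)
have NE : ip u u = (opnorm (rank1 ip u v))%:C%C.
  rewrite opnorm_rank1//; have -> : `|v| = `|u|.
    apply/eqP; by rewrite -(eqrXn2 (n := 2))// !ipH uv.
  by rewrite -expr2 ipH.
have N0 : 0 < opnorm (rank1 ip u v) by rewrite -ltcR -NE dnorm_gt0.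
rewrite -trE NE in tN; rewrite trE in trT_neq0 tN.
split; last first.
  move=> m n l mn _; rewrite /trace_norm_condition.
  by apply: trace_norm_arg_form => //; rewrite trE.
have SE : gen_semigroup [set rank1 ip u v; adjoint ip (rank1 ip u v)] =
    word_semigroup ip u v.
  by rewrite adjoint_rank1// /word_semigroup /wordop !scale1r.
rewrite SE.
have vvE := etrans (esym uv) NE.
have SI := SI_conditions ipH erefl NE vvE trT_neq0 tN.
(* This turns the inclusive alternative from [SI_conditions] into an exclusive one. *)
have excl : real_unit -> ~ trace_norm.
  move=> [_ N1] [m [n [l [mn _]]]]; rewrite /trace_norm_condition trE.
  by apply: (conditions_exclusive tN) mn _; rewrite N1.
split=> [/SI[[m [n [l [mn l1 w1]]]]|[tR N1]]|].
- have tn : trace_norm by exists m, n, l; rewrite /trace_norm_condition trE.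
  by left; split=> // /excl.
- have ru : real_unit by rewrite /real_unit trE; split=> //; apply: complexI.
  by right; split=> //; exact: excl.
move=> [[[m [n [l [mn l1 w1]]]] _]|[_ [tR N1]]].
- rewrite /trace_norm_condition trE in w1.
  exact: (SI_of_weight1 ipH erefl NE vvE trT_neq0 tN mn l1 w1).
- rewrite trE in tR; apply: (SI_of_real_unit ipH erefl NE vvE tN tR).
  by rewrite N1.
Qed.
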